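(* For every real Banach space $Y\neq\{0\}$ and every $\varepsilon\in(0,1)$ $$\Phi^S(\ell_1^{(2)},Y,\varepsilon)\ge\min\{\sqrt{2\varepsilon},\,1\}.$$ In particular, $\Phi^S(\ell_1^{(2)},Y,\varepsilon)=\min\{\sqrt{2\varepsilon},\,1\}$ if $\beta(Y)=0$.
   Context: All Banach spaces are real. $\ell_1^{(2)}$ is $\mathbb{R}^2$ with the norm $|x_1|+|x_2|$. $S_X$ denotes the unit sphere of $X$; $L(X,Y)$ is the space of bounded linear operators $X\to Y$ with the operator norm. $\beta(Y)=0$ means that $Y$ has Lindenstrauss' property $\beta$ with parameter $0$: there are two sets $\{y_\alpha:\alpha\in\Lambda\}\subset S_Y$ and $\{y^*_\alpha:\alpha\in\Lambda\}\subset S_{Y^*}$ such that (i) $y^*_\alpha(y_\alpha)=1$ for all $\alpha$; (ii) $y^*_\alpha(y_\gamma)=0$ whenever $\alpha\ne\gamma$; (iii) $\|y\|=\sup\{|y^*_\alpha(y)|:\alpha\in\Lambda\}$ for all $y\in Y$. Spherical Bishop-Phelps-Bollobás modulus: for $\varepsilon\in(0,1)$, $\Phi^S(X,Y,\varepsilon)$ is the infimum of those $\delta>0$ such that for every $(x,T)\in S_X\times S_{L(X,Y)}$ with $\|T(x)\|>1-\varepsilon$ there is $(z,F)\in S_X\times S_{L(X,Y)}$ with $\|F(z)\|=1$, $\|x-z\|<\delta$ and $\|T-F\|<\delta$. *)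

(* Defs.v *)
From HB Require Import structures.
From mathcomp Require Import all_boot all_order all_algebra.
From mathcomp Require Import all_classical all_reals all_analysis.

Set Implicit Arguments.
Unset Strict Implicit.
Unset Printing Implicit Defensive.

Import Order.TTheory GRing.Theory Num.Theory.
Import numFieldNormedType.Exports.

Local Open Scope classical_set_scope.
Local Open Scope ring_scope.

(* An alias of 'rV[R]_n, because 'rV[R]_n itself carries the sup norm. *)
Definition ell1 (R : realType) (n : nat) : Type := 'rV[R]_n.

HB.instance Definition _ (R : realType) (n : nat) :=
  GRing.Lmodule.copy (ell1 R n) 'rV[R]_n.

Section ell1.
Context (R : realType) (n : nat).
Implicit Types x y : ell1 R n.

Definition ell1_norm x : R := \sum_(i < n) `|x ord0 i|.

Lemma ell1_norm_triangle x y : ell1_norm (x + y) <= ell1_norm x + ell1_norm y.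
Proof.
by rewrite /ell1_norm -big_split; apply: ler_sum => i _; rewrite mxE ler_normD.
Qed.

Lemma ell1_normZ (l : R) x : ell1_norm (l *: x) = `|l| * ell1_norm x.
Proof.
by rewrite /ell1_norm mulr_sumr; apply: eq_bigr => i _; rewrite mxE normrM.
Qed.

Lemma ell1_norm_eq0 x : ell1_norm x = 0 -> x = 0.
Proof.
move=> /eqP; rewrite psumr_eq0// => /allP x0; apply/rowP => i; rewrite mxE.
by have := x0 i (mem_index_enum _); rewrite normr_eq0 => /eqP.
Qed.

HB.instance Definition _ := @Lmodule_isNormed.Build R (ell1 R n)
  ell1_norm ell1_norm_triangle ell1_normZ ell1_norm_eq0.

Lemma ell1_normE x : `|x| = \sum_(i < n) `|x ord0 i|.
Proof. by []. Qed.

Lemma ell1_complete (F : set_system (ell1 R n)) :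
  ProperFilter F -> cauchy F -> cvg F.
Proof.
move=> FF /cauchyP Fc.
have coord_le x i : `|x ord0 i| <= `|x|.
  by rewrite ell1_normE (bigD1 i)//= lerDl sumr_ge0.
have Fi i : cvg ((fun x : ell1 R n => x ord0 i) @ F).
  apply/cauchy_cvgP/cauchyP => e e0; have [y yF] := Fc e e0.
  exists (y ord0 i).
  change (F [set x : ell1 R n | ball (y ord0 i) e (x ord0 i)]).
  apply: filterS yF => x /=.
  rewrite -!ball_normE /=; apply: le_lt_trans.
  by have := coord_le (y - x) i; rewrite !mxE.
pose l : ell1 R n := \row_i lim ((fun x : ell1 R n => x ord0 i) @ F).
apply/cvg_ex; exists l; apply/cvgrPdist_lt => e e0.
have d0 : 0 < e / n.+1%:R by rewrite divr_gt0// ltr0n.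
have : F [set x : ell1 R n | forall i, `|l ord0 i - x ord0 i| < e / n.+1%:R].
  apply: filter_forall => i; rewrite mxE.
  by have /cvgrPdist_lt/(_ _ d0) := Fi i.
apply: filterS => x lx; rewrite ell1_normE.
apply: (@le_lt_trans _ _ (\sum_(i < n) e / n.+1%:R)).
  by apply: ler_sum => i _; have := lx i; rewrite !mxE => /ltW.
rewrite sumr_const card_ord -[_ *+ n]mulr_natr -mulrA gtr_pMr// mulrC.
by rewrite ltr_pdivrMr ?ltr0n// mul1r ltr_nat.
Qed.

HB.instance Definition _ := Uniform_isComplete.Build (ell1 R n) ell1_complete.

End ell1.

Definition unit_sphere (R : realType) (X : normedModType R) : set X :=
  [set x | `|x| = 1].

(* A real-valued sup, meaningful only for bounded f. *)
Definition opnorm (R : realType) (X Y : normedModType R) (f : X -> Y) : R :=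
  sup [set `|f x| | x in [set x : X | `|x| <= 1]].

(* By linear_boundedP, a linear map is bounded near 0 iff it is a bounded
   operator. *)
Definition operator_sphere (R : realType) (X Y : normedModType R) :
    set {linear X -> Y} :=
  [set T : {linear X -> Y} | bounded_near T (nbhs (0 : X)) /\ opnorm T = 1].

(* The set below is bounded below by 0.  It is never empty: for X, Y <> 0 the
   Hahn-Banach theorem provides a norm-attaining rank one operator and any
   delta > 2 belongs to the set; if X or Y is 0 then every delta > 0 does. *)
Definition PhiS (R : realType) (X Y : completeNormedModType R) (eps : R) : R :=
  inf [set delta : R | 0 < delta /\
    forall (x : X) (T : {linear X -> Y}),
      unit_sphere x -> operator_sphere T -> `|T x| > 1 - eps ->
      exists (z : X) (F : {linear X -> Y}),
        [/\ unit_sphere z, operator_sphere F, `|F z| = 1,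
            `|x - z| < delta & opnorm (T \- F) < delta]].

Definition property_beta0 (R : realType) (Y : completeNormedModType R) : Prop :=
  exists (Lambda : Type) (y : Lambda -> Y) (ystar : Lambda -> {linear Y -> R^o}),
    [/\ forall a, unit_sphere (y a) /\ operator_sphere (ystar a),
        forall a, ystar a (y a) = 1,
        forall a c, a <> c -> ystar a (y c) = 0 &
        forall v : Y, `|v| = sup (range (fun a => `|ystar a v| : R))].

(* Main.v *)
Require Import Defs.
From HB Require Import structures.
From mathcomp Require Import all_boot all_order all_algebra.
From mathcomp Require Import all_classical all_reals all_analysis.
From mathcomp Require Import lra.
Import Order.TTheory GRing.Theory Num.Theory.
Import numFieldNormedType.Exports.
Local Open Scope classical_set_scope.
Local Open Scope ring_scope.

(** An operator [T] on [l_1^2] is the pair [(T e_1, T e_2)], with norm the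
    maximum of the two norms, and an operator of norm one attaining its norm at
    [z] satisfies [|F e_i| = 1] as soon as [z_i <> 0].

    Lower bound: for [s < min (sqrt (2 eps)) 1] and a unit vector [u], take
    [T e_1 = u], [T e_2 = (1 - s) u] and [x = (1 - s/2, s/2)], so that
    [|T x| = 1 - s^2/2 > 1 - eps].  If [F] attains its norm at [z], then either
    [z_2 <> 0], so that [|F e_2| = 1] and [|T - F| >= s], or [z = (+-1, 0)] and
    [|x - z| >= s].

    Upper bound: pick [alpha] with [|y*_alpha (T x)| > 1 - eps].  Moving [T e_i]
    along [y_alpha] changes no other coordinate functional, which reduces the
    problem to the functional [y*_alpha \o T], i.e. to [Y = R].  There, with
    [x_1 >= x_2 >= 0], one can take [z = (1, 0)] when [x_2] is small, and [z = x]
    otherwise. *)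

(** * Operators of norm one between normed spaces *)

Section opnorm.
Context (R : realType) (X Y : normedModType R).
Implicit Types f : X -> Y.

Lemma opnorm_le f (c : R) :
  (forall x, `|x| <= 1 -> `|f x| <= c) -> opnorm f <= c.
Proof.
move=> fc; apply: ge_sup; first by exists `|f 0|, 0 => //=; rewrite normr0.
by move=> _ [x /= x1 <-]; exact: fc.
Qed.

Lemma le_opnorm f (c : R) x :
  (forall x, `|x| <= 1 -> `|f x| <= c) -> `|x| <= 1 -> `|f x| <= opnorm f.
Proof.
move=> fc x1; apply: ub_le_sup; last by exists x.
by exists c => _ [z /= z1 <-]; exact: fc.
Qed.

Lemma operator_sphere_le (T : {linear X -> Y}) x :
  operator_sphere T -> `|T x| <= `|x|.
Proof.
case=> _ T1; have [->|x0] := eqVneq x 0; first by rewrite linear0 !normr0.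
have nx0 : 0 < `|x| by rewrite normr_gt0.
(* [sup] is 0 on a set that has no supremum, so the value 1 forces this set to be bounded. *)
have hs : has_sup [set `|T x| | x in [set x : X | `|x| <= 1]].
  apply: contrapT => /sup_out; rewrite -/(opnorm T) T1 => /eqP.
  by rewrite oner_eq0.
have : `|T (`|x|^-1 *: x)| <= opnorm T.
  apply: ub_le_sup; first by case: hs.
  by exists (`|x|^-1 *: x) => //=; rewrite normrZ normfV normr_id mulVf ?gt_eqF.
by rewrite T1 linearZ normrZ normfV normr_id mulrC ler_pdivrMr// mul1r.
Qed.

Lemma operator_sphere_attaining (F : {linear X -> Y}) z :
  (forall x, `|F x| <= `|x|) -> `|z| = 1 -> `|F z| = 1 -> operator_sphere F.
Proof.
move=> Fle z1 Fz1; split.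
  apply/linear_boundedP; near=> r => x; rewrite (le_trans (Fle x))//.
  by rewrite ler_peMl//; near: r; exact: nbhs_pinfty_ge.
have F1 x : `|x| <= 1 -> `|F x| <= 1 by move=> ?; exact: le_trans (Fle x) _.
apply/eqP; rewrite eq_le opnorm_le//=.
by rewrite -[leLHS]Fz1 (@le_opnorm _ 1)// z1.
Unshelve. all: end_near. Qed.

End opnorm.

(** * Operators on [l_1^n] through their values on the basis *)

Section ell1_operators.
Context (R : realType) (n : nat) (Y : normedModType R).
Implicit Types (x : ell1 R n) (a : 'I_n -> Y).

Definition ell1_op a x : Y := \sum_(i < n) x ord0 i *: a i.

Lemma ell1_op_is_linear a : linear (ell1_op a).
Proof.
move=> k x y; rewrite /ell1_op scaler_sumr -big_split; apply: eq_bigr => i _.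
by rewrite !mxE scalerDl scalerA.
Qed.

HB.instance Definition _ a :=
  GRing.isLinear.Build R (ell1 R n) Y *:%R (ell1_op a) (ell1_op_is_linear a).

Definition ell1_basis (i : 'I_n) : ell1 R n := delta_mx ord0 i.

Lemma ell1_linearE (T : {linear ell1 R n -> Y}) x :
  T x = \sum_(i < n) x ord0 i *: T (ell1_basis i).
Proof.
rewrite {1}(row_sum_delta x : x = \sum_i x ord0 i *: ell1_basis i).
by rewrite linear_sum; apply: eq_bigr => i _; rewrite linearZ.
Qed.

Lemma norm_ell1_basis i : `|ell1_basis i| = 1.
Proof.
rewrite ell1_normE (bigD1 i)//= mxE !eqxx normr1 big1 ?addr0// => j ji.
by rewrite mxE eqxx (negPf ji) normr0.
Qed.

Lemma ell1_op_basis a i : ell1_op a (ell1_basis i) = a i.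
Proof.
rewrite /ell1_op (bigD1 i)//= mxE !eqxx scale1r big1 ?addr0// => j ji.
by rewrite mxE eqxx (negPf ji) scale0r.
Qed.

Lemma ell1_linear_le (T : {linear ell1 R n -> Y}) (c : R) x :
  (forall i, `|T (ell1_basis i)| <= c) -> `|T x| <= c * `|x|.
Proof.
move=> Tc; rewrite ell1_linearE ell1_normE mulr_sumr.
apply: le_trans (ler_norm_sum _ _ _) _; apply: ler_sum => i _.
by rewrite normrZ mulrC ler_wpM2r.
Qed.

Lemma ell1_opB_norm_le (T F : {linear ell1 R n -> Y}) (c : R) :
  0 <= c -> (forall i, `|T (ell1_basis i) - F (ell1_basis i)| <= c) ->
  opnorm (T \- F) <= c.
Proof.
move=> c0 TFc; apply: opnorm_le => x x1.
apply: le_trans (ell1_linear_le (T \- F) c x TFc) _.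
by rewrite ler_piMr.
Qed.

End ell1_operators.

(** * The scalar problem on [l_1^2] *)

Section plane.
Context {R : realType}.

Definition ord2_fun {T : Type} (a b : T) (i : 'I_2) : T :=
  if i == ord0 then a else b.

Definition ell1_pair (a b : R) : ell1 R 2 := \row_i ord2_fun a b i.

Lemma forall_ord2 (P : 'I_2 -> Prop) : P ord0 -> P ord_max -> forall i, P i.
Proof.
move=> P0 P1 i; have [->//|i0] := eqVneq i ord0.
by rewrite (_ : i = ord_max)//; case: i i0 => [[|[|]]] // ? _; exact: val_inj.
Qed.

Lemma sum_ord2 (V : zmodType) (f : 'I_2 -> V) :
  \sum_(i < 2) f i = f ord0 + f ord_max.
Proof.
by rewrite big_ord_recl big_ord1 (_ : lift _ _ = ord_max)//; exact: val_inj.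
Qed.

Lemma norm_ell1_pair (a b : R) : `|ell1_pair a b| = `|a| + `|b|.
Proof. by rewrite ell1_normE sum_ord2 !mxE. Qed.

Lemma norm_ell1_subpair (x : ell1 R 2) (a b : R) :
  `|x - ell1_pair a b| = `|x ord0 ord0 - a| + `|x ord0 ord_max - b|.
Proof. by rewrite ell1_normE sum_ord2 !mxE. Qed.

(** The Bishop-Phelps-Bollobás conclusion for [Y = R] in coordinates: [(p, q)] are the values of the
    functional on the basis, [(z1, z2)] is the new point and [(p', q')] the new functional. *)
Definition scalar_approx (delta x1 x2 p q : R) : Prop :=
  exists z1 z2 p' q' : R,
    [/\ `|z1| + `|z2| = 1, `|p'| <= 1 /\ `|q'| <= 1,
        `|p' * z1 + q' * z2| = 1, `|x1 - z1| + `|x2 - z2| < delta &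
        `|p - p'| < delta /\ `|q - q'| < delta].

(* When [1 < delta], even a functional with [p < 0] can be corrected, by making
   it attain [-1] at [(1, 0)]: one of [+-1] is at distance at most [1] of [p]. *)
Lemma scalar_bpb_nonneg (eps delta x1 x2 p q : R) :
  0 < delta -> 1 < delta \/ 2 * eps < delta ^+ 2 ->
  0 <= x2 -> x2 <= x1 -> x1 + x2 = 1 -> `|p| <= 1 -> `|q| <= 1 ->
  1 - eps < p * x1 + q * x2 ->
  scalar_approx delta x1 x2 p q.
Proof.
move=> d0 dP x20 x21 x1E p1 q1 pq.
have [d1|d1] := ltP 1 delta.
  have e1x : `|x1 - 1| + `|x2 - 0| < delta.
    by rewrite ler0_norm ?ger0_norm; lra.
  exists 1, 0, (if 0 <= p then 1 else -1), q.
  have [p0|p0] := ifPn; split; rewrite ?subrr ?normr0 ?normr1 ?normrN1 ?addr0;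
    rewrite ?mulr1 ?mulr0 ?addr0 ?normr1 ?normrN1//; split => //.
    by move: p1; rewrite ler_norml => /andP[? ?]; rewrite ltr_norml; lra.
  move: p1 p0; rewrite -ltNge ler_norml => /andP[? ?] ?.
  by rewrite ltr_norml; lra.
have {}dP : 2 * eps < delta ^+ 2 by case: dP => //; lra.
have dd : delta ^+ 2 <= delta by rewrite expr2; nra.
move: (p1) (q1); rewrite !ler_norml => /andP[p1l p1r] /andP[q1l q1r].
(* As [q <= 1], the hypothesis gives [(1 - p) x1 < eps]; with [x1 >= 1/2],
   [1 - p < 2 eps < delta^2 <= delta]. *)
have pd : `|p - 1| < delta.
  have : (1 - p) * x1 < eps by nra.
  by move=> ?; rewrite ltr_norml; nra.
(* The distance from [x] to [(1, 0)] is [2 x2]. *)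
have [x2d|x2d] := ltP (2 * x2) delta.
  exists 1, 0, 1, q; split; rewrite ?subrr ?normr0 ?normr1 ?addr0//.
  - by rewrite mulr1 mulr0 addr0 normr1.
  - by rewrite subr0 ler0_norm ?ger0_norm; lra.
exists x1, x2, 1, 1; split; rewrite ?subrr ?normr0 ?normr1 ?addr0//.
- by rewrite !ger0_norm; lra.
- by rewrite !mul1r x1E normr1.
split=> //.
(* Now [x2 >= delta / 2], so [1 - q < 2 eps / delta < delta]; this is the source of the threshold
   [sqrt (2 eps)]. *)
have h : (1 - q) * x2 < eps by nra.
by rewrite ltr_norml; nra.
Qed.

(** The problem is invariant under swapping the coordinates, changing the sign of a coordinate along
    with its coefficient, and negating the functional. *)
Lemma scalar_bpb (eps delta x1 x2 p q : R) :
  0 < delta -> 1 < delta \/ 2 * eps < delta ^+ 2 ->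
  `|x1| + `|x2| = 1 -> `|p| <= 1 -> `|q| <= 1 ->
  1 - eps < `|p * x1 + q * x2| ->
  scalar_approx delta x1 x2 p q.
Proof.
move=> d0 dP.
wlog x21 : x1 x2 p q / `|x2| <= `|x1|.
  move=> H x1E p1 q1 pq.
  have [x21|/ltW x12] := leP `|x2| `|x1|; first exact: H.
  have [z1 [z2 [p' [q' [zE [? ?] Fz xz [? ?]]]]]] :
    scalar_approx delta x2 x1 q p.
  - by apply: H => //; [rewrite addrC | rewrite [X in `|X|]addrC].
  - by exists z2, z1, q', p'; split=> //; rewrite addrC.
wlog x10 : x1 x2 p q x21 / 0 <= x1.
  move=> H x1E p1 q1 pq.
  have [x10|/ltW x10] := leP 0 x1; first exact: H.
  have [z1 [z2 [p' [q' [zE [? ?] Fz xz [pp ?]]]]]] :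
    scalar_approx delta (- x1) x2 (- p) q.
  - by apply: H; rewrite ?normrN ?mulrNN ?oppr_ge0.
  - exists (- z1), z2, (- p'), q'; split; rewrite ?normrN ?mulrNN//.
      by rewrite -[`|x1 - _|]normrN opprD opprK.
    by rewrite -normrN opprD opprK.
wlog x20 : x1 x2 p q x21 x10 / 0 <= x2.
  move=> H x1E p1 q1 pq.
  have [x20|/ltW x20] := leP 0 x2; first exact: H.
  have [z1 [z2 [p' [q' [zE [? ?] Fz xz [? qq]]]]]] :
    scalar_approx delta x1 (- x2) p (- q).
  - by apply: H; rewrite ?normrN ?mulrNN ?oppr_ge0.
  - exists z1, (- z2), p', (- q'); split; rewrite ?normrN ?mulrNN//.
      by rewrite -[`|x2 - _|]normrN opprD opprK.
    by rewrite -[`|q - _|]normrN opprD opprK.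
move: x21; rewrite (ger0_norm x10) (ger0_norm x20) => x21.
wlog pq0 : p q / 0 <= p * x1 + q * x2.
  move=> H x1E p1 q1 pq.
  have [pq0|/ltW pq0] := leP 0 (p * x1 + q * x2); first exact: H.
  have [z1 [z2 [p' [q' [zE [? ?] Fz xz [pp qq]]]]]] :
    scalar_approx delta x1 x2 (- p) (- q).
  - by apply: H; rewrite ?normrN// !mulNr -opprD ?oppr_ge0 ?normrN.
  - exists z1, z2, (- p'), (- q'); split; rewrite ?normrN//.
      by rewrite !mulNr -opprD normrN.
    by rewrite -normrN opprD opprK -[`|q - _|]normrN opprD opprK.
by move=> x1E p1 q1; rewrite ger0_norm// => pq; exact: scalar_bpb_nonneg pq.
Qed.

End plane.

(** * The set of admissible radii, whose infimum is [PhiS], and its bounds *)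

Definition bpb_radii {R : realType} (X Y : completeNormedModType R) (eps : R) :
    set R :=
  [set delta : R | 0 < delta /\
    forall (x : X) (T : {linear X -> Y}),
      unit_sphere x -> operator_sphere T -> `|T x| > 1 - eps ->
      exists (z : X) (F : {linear X -> Y}),
        [/\ unit_sphere z, operator_sphere F, `|F z| = 1,
            `|x - z| < delta & opnorm (T \- F) < delta]].

Section spherical_modulus.
Context (R : realType) (Y : completeNormedModType R).
Implicit Types (eps delta : R) (T F : {linear ell1 R 2 -> Y}).

Lemma ell1_linear2E T (x : ell1 R 2) :
  T x = x ord0 ord0 *: T (ell1_basis R 2 ord0)
        + x ord0 ord_max *: T (ell1_basis R 2 ord_max).
Proof. by rewrite ell1_linearE sum_ord2. Qed.

Lemma ell1_operator_sphere T (z : ell1 R 2) :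
  (forall i, `|T (ell1_basis R 2 i)| <= 1) -> `|z| = 1 -> `|T z| = 1 ->
  operator_sphere T.
Proof.
move=> T1; apply: operator_sphere_attaining => x.
by rewrite -[leRHS]mul1r; exact: ell1_linear_le.
Qed.

Lemma opnorm_subT_ge T F x : operator_sphere T -> operator_sphere F ->
  `|x| <= 1 -> `|T x - F x| <= opnorm (T \- F).
Proof.
(* The bound 2 on the unit ball ensures that the [sup] in [opnorm] dominates each value. *)
move=> TS FS x1; apply: (@le_opnorm _ _ _ (T \- F) 2) => // {x1}x x1 /=.
rewrite (le_trans (ler_normB _ _))// (_ : 2 = 1 + 1)//.
by apply: lerD; apply: le_trans x1; exact: operator_sphere_le.
Qed.

Lemma exists_unit : (exists y : Y, y != 0) -> exists u : Y, `|u| = 1.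
Proof.
case=> y y0; exists (`|y|^-1 *: y).
by rewrite normrZ normfV normr_id mulVf// normr_eq0.
Qed.

(** Unit vectors, and operators of norm one, are at distance at most 2, so one norm-attaining
    operator serves all pairs [(x, T)]. Nonemptiness lets lower bounds pass to the [inf]. *)
Lemma bpb_radii_nonempty eps :
  (exists y : Y, y != 0) -> bpb_radii (ell1 R 2) Y eps !=set0.
Proof.
move=> /exists_unit[u u1]; exists 3; split=> // x T x1 TS _.
pose F : {linear ell1 R 2 -> Y} := ell1_op R 2 Y (fun=> u).
have z1 := norm_ell1_basis R 2 ord0.
have FS : operator_sphere F.
  by apply: (ell1_operator_sphere _ _ _ z1) => [i|]; rewrite /F/= ell1_op_basis u1.
exists (ell1_basis R 2 ord0), F; split => //.
- by rewrite /F/= ell1_op_basis.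
- by rewrite (le_lt_trans (ler_normB _ _))// x1 z1; lra.
- apply: (@le_lt_trans _ _ 2); last by lra.
  apply: ell1_opB_norm_le => // i; rewrite (le_trans (ler_normB _ _))//.
  rewrite (_ : 2 = 1 + 1)//; apply: lerD; rewrite -(norm_ell1_basis R 2 i);
  exact: operator_sphere_le.
Qed.

Lemma bpb_radii_ge eps delta : (exists y : Y, y != 0) ->
  bpb_radii (ell1 R 2) Y eps delta -> Num.min (Num.sqrt (2 * eps)) 1 <= delta.
Proof.
(* The radius itself, assumed too small, serves as the parameter [s] of the counterexample. *)
move=> /exists_unit[u u1] [s0 bpb]; set s := delta in s0 bpb *.
rewrite leNgt; apply/negP; rewrite lt_min => /andP[s2 s1].
have {}s2 : s ^+ 2 < 2 * eps.
  have e0 : 0 < 2 * eps by rewrite -sqrtr_gt0 (lt_trans s0).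
  by rewrite -(sqr_sqrtr (ltW e0)) ltr_pXn2r// nnegrE ?ltW// sqrtr_gt0.
pose T : {linear ell1 R 2 -> Y} := ell1_op R 2 Y (ord2_fun u ((1 - s) *: u)).
have Te i : T (ell1_basis R 2 i) = ord2_fun u ((1 - s) *: u) i.
  by rewrite /T/= ell1_op_basis.
have sN : `|1 - s| = 1 - s by rewrite ger0_norm// subr_ge0 ltW.
have TS : operator_sphere T.
  apply: (ell1_operator_sphere _ _ _ (norm_ell1_basis R 2 ord0)); last by rewrite Te.
  by apply: forall_ord2; rewrite Te /ord2_fun/= ?normrZ ?sN u1; lra.
pose x := ell1_pair (1 - s / 2) (s / 2).
have x1 : `|x| = 1 by rewrite norm_ell1_pair !ger0_norm; lra.
have Tx : 1 - eps < `|T x|.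
  rewrite ell1_linear2E !Te !mxE /ord2_fun/= scalerA -scalerDl normrZ u1 mulr1.
  by rewrite (lt_le_trans _ (ler_norm _))//; move: s2; rewrite expr2; nra.
have [z [F [z1 FS Fz xz TF]]] := bpb x T x1 TS Tx.
rewrite /unit_sphere/= ell1_normE sum_ord2 in z1.
have Fe i : `|F (ell1_basis R 2 i)| <= 1.
  by rewrite -(norm_ell1_basis R 2 i); exact: operator_sphere_le.
have [z20|z20] := eqVneq (z ord0 ord_max) 0.
  move: xz; rewrite ell1_normE sum_ord2 !mxE/= /ord2_fun/= z20 subr0.
  move: z1; rewrite z20 normr0 addr0 => z1.
  have : z ord0 ord0 <= 1 by rewrite -z1 ler_norm.
  have := ler_norm (- z ord0 ord0); rewrite normrN z1.
  have [->|->] : z ord0 ord0 = 1 \/ z ord0 ord0 = -1.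
  - have := eqr_norml (z ord0 ord0) 1; rewrite z1 eqxx ler01 andbT.
    by move=> /esym/orP[]/eqP ->; [left|right].
  - by rewrite ler0_norm ?ger0_norm; lra.
  - by rewrite !ger0_norm; lra.
(* [1 = |F z| <= |z_1| + |z_2| |F e_2|], while [|z_1| + |z_2| = 1] and [z_2 <> 0]. *)
have Fe2 : 1 <= `|F (ell1_basis R 2 ord_max)|.
  have : `|F z| <= `|z ord0 ord0| + `|z ord0 ord_max| * `|F (ell1_basis R 2 ord_max)|.
    rewrite ell1_linear2E (le_trans (ler_normD _ _))// !normrZ lerD2r.
    by rewrite ler_piMr.
  by rewrite Fz -[X in X <= _ -> _]z1 lerD2l ler_pMr// normr_gt0.
have := opnorm_subT_ge _ _ (ell1_basis R 2 ord_max) TS FS.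
rewrite norm_ell1_basis lexx => /(_ isT).
have := lerB_dist (F (ell1_basis R 2 ord_max)) (T (ell1_basis R 2 ord_max)).
rewrite distrC [in `|T _|]Te /ord2_fun/= normrZ u1 sN.
lra.
Qed.

Lemma beta0_bpb_radii eps delta : eps < 1 -> property_beta0 Y ->
  0 < delta -> 1 < delta \/ 2 * eps < delta ^+ 2 ->
  bpb_radii (ell1 R 2) Y eps delta.
Proof.
move=> e1 [Lam [y [ys [yS ysy ys0 ysup]]]] d0 dP; split=> // x T x1 TS Tx.
have ysle a v : `|ys a v| <= `|v| by apply: operator_sphere_le; case: (yS a).
have [a aTx] : exists a, 1 - eps < `|ys a (T x)|.
  (* Without a supremum, the default value 0 would give [|T x| = 0], against
     [|T x| > 1 - eps > 0]. *)
  have hs : has_sup (range (fun a => `|ys a (T x)| : R)).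
    apply: contrapT => /sup_out; rewrite -ysup => Tx0.
    by move: Tx; rewrite Tx0; lra.
  have : 1 - eps < sup (range (fun a => `|ys a (T x)| : R)) by rewrite -ysup.
  by case/(sup_gt (proj1 hs)) => _ [a _ <-] ?; exists a.
pose e := ell1_basis R 2.
have Te i : `|T (e i)| <= 1.
  by rewrite -(norm_ell1_basis R 2 i); exact: operator_sphere_le.
have yse i : `|ys a (T (e i))| <= 1 by exact: le_trans (ysle _ _) (Te i).
rewrite /unit_sphere/= ell1_normE sum_ord2 in x1.
have aTx' : 1 - eps < `|ys a (T (e ord0)) * x ord0 ord0
                        + ys a (T (e ord_max)) * x ord0 ord_max|.
  move: aTx; rewrite ell1_linear2E linearD !linearZ/=.
  by rewrite ![_ *: (_ : R^o)]mulrC.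
have [z1 [z2 [p' [q' [zE [p'1 q'1] Fz xz [pp qq]]]]]] :=
  scalar_bpb _ _ _ _ _ _ d0 dP x1 (yse ord0) (yse ord_max) aTx'.
(* The correction along [y a] that gives [ys a \o F] the values [p'] and [q'] on the basis. *)
pose c i : R := ord2_fun p' q' i - ys a (T (e i)).
pose F : {linear ell1 R 2 -> Y} := ell1_op R 2 Y (fun i => T (e i) + c i *: y a).
have FE i : F (e i) = T (e i) + c i *: y a by rewrite /F/= ell1_op_basis.
have y1 : `|y a| = 1 by case: (yS a).
have ysF i : ys a (F (e i)) = ord2_fun p' q' i.
  by rewrite FE linearD linearZ/= ysy /c /GRing.scale/= mulr1 addrC subrK.
have Fe i : `|F (e i)| <= 1.
  rewrite ysup; apply: ge_sup; first by exists `|ys a (F (e i))|, a.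
  move=> _ [g _ <-]; have [->|ga] := pselect (g = a).
    by rewrite ysF; move: i; exact: forall_ord2.
  rewrite FE linearD linearZ/= (ys0 _ _ ga).
  by rewrite scaler0 addr0 (le_trans (ysle _ _)).
have z1N : `|ell1_pair z1 z2| = 1 by rewrite norm_ell1_pair.
have Fz1 : `|F (ell1_pair z1 z2)| = 1.
  apply/eqP; rewrite eq_le -{1}z1N -[X in _ <= X]mul1r ell1_linear_le//=.
  apply: le_trans (ysle a _).
  rewrite ell1_linear2E linearD !linearZ/= !ysF !mxE /ord2_fun/=.
  by rewrite -Fz ![_ *: (_ : R^o)]mulrC.
exists (ell1_pair z1 z2), F; split => //.
- exact: ell1_operator_sphere Fe z1N Fz1.
- by rewrite norm_ell1_subpair.
(* [T - F] maps [e_i] to [- c i *: y a]; bounding by the maximum keeps the inequality strict. *)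
- apply: (@le_lt_trans _ _ (Num.max `|c ord0| `|c ord_max|)).
    apply: ell1_opB_norm_le => [|i]; first by rewrite le_max normr_ge0.
    rewrite -/(e i) FE opprD addrA subrr sub0r normrN normrZ y1 mulr1.
    by move: i; apply: forall_ord2; rewrite le_max lexx ?orbT.
  by rewrite gt_max /c /ord2_fun/= [in X in X && _]distrC [in X in _ && X]distrC pp.
Qed.

End spherical_modulus.

Theorem theorem3p4 (R : realType) (Y : completeNormedModType R)
    (Y_neq0 : exists y : Y, y != 0) (eps : R) (eps_gt0 : 0 < eps)
    (eps_lt1 : eps < 1) :
  Num.min (Num.sqrt (2 * eps)) 1 <= PhiS (ell1 R 2) Y eps /\
  (property_beta0 Y ->
   PhiS (ell1 R 2) Y eps = Num.min (Num.sqrt (2 * eps)) 1).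
Proof.
have PhiS_ge : Num.min (Num.sqrt (2 * eps)) 1 <= PhiS (ell1 R 2) Y eps.
  apply: lb_le_inf; first exact: bpb_radii_nonempty.
  by move=> delta; exact: bpb_radii_ge.
split=> // Ybeta; apply/eqP; rewrite eq_le PhiS_ge andbT.
(* Adding any [r > 0] to the bound yields the strict inequalities of [beta0_bpb_radii]. *)
apply/ler_addgt0Pr => r r0; apply: ge_inf.
  by exists 0 => delta [/ltW].
have e2 : 0 < 2 * eps by rewrite mulr_gt0.
apply: beta0_bpb_radii => //.
  by rewrite addr_gt0// lt_min sqrtr_gt0 e2 ltr01.
have [h|h] := leP (Num.sqrt (2 * eps)) 1; last by left; lra.
right; rewrite -{1}(sqr_sqrtr (ltW e2)) ltr_pXn2r ?nnegrE ?sqrtr_ge0//.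
  by rewrite ltrDl.
by rewrite addr_ge0 ?sqrtr_ge0 ?ltW.
Qed.
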